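(* Let $m\ge 2$ be an integer, and for $n\ge1$ let $N=m^n$ and $\sigma_n\sim\mathrm{Unif}(B_{s,n}^{(m)})$. Then \[ L(\sigma_n)\sim\prod_{j=1}^n\max(X_j,m-X_j) \] (equality in distribution), where $X_1,\dots,X_n$ are i.i.d. uniform on $\{1,\dots,m\}$, and $\mathbb E\,L(\sigma_n)=N^{\alpha_m}$. Moreover, as $n\to\infty$, $(\log_m L(\sigma_n)-\mu_m n)(\nu_m n)^{-1/2}$ converges in distribution to a standard normal random variable $Z\sim N(0,1)$.
   Context: $L(\sigma)$ denotes the length of the longest increasing subsequence of a permutation $\sigma$, i.e. the largest $k$ for which there are $i_1<\dots<i_k$ with $\sigma(i_1)<\dots<\sigma(i_k)$. For permutations $\sigma\in S_a,\tau\in S_b$, $\sigma\otimes\tau\in S_{ab}$ is the permutation with $P_{\sigma\otimes\tau}=P_\sigma\otimes P_\tau$ (Kronecker product), where $P_\sigma\mathbf e_k=\mathbf e_{\sigma(k)}$. Let $\tau_m=(1\ 2\ \cdots\ m)\in S_m$ be the standard $m$-cycle. The group of simple $m$-nary butterfly permutations is $B_{s,n}^{(m)}=\bigotimes_{j=1}^n\langle\tau_m\rangle=\{\sigma_1\otimes\cdots\otimes\sigma_n:\sigma_j\in\langle\tau_m\rangle\}\subset S_{m^n}$. With $X$ uniform on $\{1,\dots,m\}$: $\mu_m=\mathbb E\log_m\max(X,m-X)$, $\nu_m=\mathrm{Var}\,\log_m\max(X,m-X)$, and $\alpha_m$ is defined by $m^{\alpha_m}=\mathbb E\max(X,m-X)=\frac{3m^2+r_m}{4m}$,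 where $r_m\in\{0,1\}$ is $m$ mod $2$. *)

(* Defs.v *)
From HB Require Import structures.
From mathcomp Require Import all_boot all_order all_algebra all_fingroup.
From mathcomp Require Import mxtens.
From mathcomp Require Import all_classical all_reals all_analysis.
From mathcomp Require Import measurable_realfun.
From mathcomp Require Import zify.

Set Implicit Arguments.
Unset Strict Implicit.
Unset Printing Implicit Defensive.
Import Order.TTheory GRing.Theory Num.Theory.
Import numFieldNormedType.Exports.

Local Open Scope classical_set_scope.
Local Open Scope ring_scope.

(* Longest increasing subsequence; a subsequence consists of distinct indices,
   so its length k is at most N. *)
Definition lis N (s : 'S_N) : nat :=
  \max_(k < N.+1 | [exists t : k.-tuple 'I_N,
      sorted (fun i j : 'I_N => (i < j)%N) t &&
      sorted (fun i j : 'I_N => (i < j)%N) (map s t)]) k.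

(* P_s e_k = e_{s k} for column vectors: the transpose of perm_mx. *)
Definition Pmx (R : pzRingType) N (s : 'S_N) : 'M[R]_N :=
  \matrix_(i, j) (i == s j)%:R.

Lemma mul_Pmx_delta (R : pzRingType) N (s : 'S_N) (k : 'I_N) :
  Pmx R s *m (delta_mx k 0 : 'cV_N) = delta_mx (s k) 0.
Proof.
apply/matrixP => i j; rewrite !mxE (bigD1 k)//= !mxE !eqxx/= ord1 eqxx andbT.
rewrite mulr1 big1 ?addr0// => l lk.
by rewrite !mxE (negbTE lk) mulr0.
Qed.

(* With 0-based indices, position (i, j) of the product is i * b + j. *)
Definition kron_fun a b (s : 'S_a) (t : 'S_b) (k : 'I_(a * b)) : 'I_(a * b) :=
  mxtens_index (s (mxtens_unindex k).1, t (mxtens_unindex k).2).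

Lemma kron_inj a b (s : 'S_a) (t : 'S_b) : injective (kron_fun s t).
Proof.
move=> k l; case: (mxtens_indexP k) => i j; case: (mxtens_indexP l) => i' j'.
rewrite /kron_fun => /(can_inj (@mxtens_indexK a b)).
by rewrite !mxtens_indexK => -[] /= /perm_inj -> /perm_inj ->.
Qed.

Definition kron a b (s : 'S_a) (t : 'S_b) : 'S_(a * b) := perm (@kron_inj a b s t).

Lemma Pmx_kron (R : pzRingType) a b (s : 'S_a) (t : 'S_b) :
  Pmx R (kron s t) = tensmx (Pmx R s) (Pmx R t).
Proof.
apply/matrixP => k l; rewrite !mxE permE /kron_fun.
case: (mxtens_indexP k) => i j; case: (mxtens_indexP l) => i' j'.
rewrite !mxtens_indexK (can_eq (@mxtens_indexK a b)) xpair_eqE.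
by rewrite -natrM mulnb.
Qed.

(* f_0 (x) (f_1 (x) (... (x) f_(n-1))); the Kronecker product is associative. *)
Fixpoint bigkron m n : ('I_n -> 'S_m) -> 'S_(m ^ n) :=
  if n is n'.+1 then fun f =>
    cast_perm (esym (expnS m n')) (kron (f ord0) (bigkron (f \o lift ord0)))
  else fun=> 1%g.

(* The m-cycle i |-> i + 1 mod m. *)
Definition mcycle m : 'S_m := perm (@ordS_inj m).

Definition butterfly m n : {set 'S_(m ^ n)} :=
  [set bigkron f | f : {ffun 'I_n -> 'S_m} in ffun_on (mem <[mcycle m]>%g)].

HB.instance Definition _ N := isPointed.Build (perm_type (ordinal N)) 1%g.
HB.instance Definition _ N := @isMeasurable.Build default_measure_display
  (perm_type (ordinal N)) discrete_measurable discrete_measurable0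
  discrete_measurableC discrete_measurableU.

Section uniform.
Context d (U : measurableType d) (R : realType).

(* Each point has mass proportional to its multiplicity in s; hence this is the
   uniform law on the set of elements of s when s is nonempty and
   duplicate-free. The Dirac mass is a default, used only for s = [::]. *)
Definition uniform_seq (s : seq U) : set U -> \bar R :=
  mnormalize (msum (fun k => \d_(nth point s k)) (size s)) \d_point.

HB.instance Definition _ s := Probability.on (uniform_seq s).

End uniform.
Arguments uniform_seq {d U} R s.

Section uniform_lemmas.
Context d (U : measurableType d) (R : realType).
Let D (s : seq U) := msum (fun k => @dirac _ U (nth point s k) R) (size s).
Let DE (s : seq U) A : D s A = ((count (fun u => u \in A) s)%:R)%:E.
Proof.
rewrite /D /msum -(big_mkord xpredT (fun k => \d_(nth point s k) A)).
rewrite -(big_nth point xpredT (fun u => \d_u A)).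
elim: s => [|u s IH]; first by rewrite big_nil.
by rewrite big_cons IH diracE /= natrD EFinD.
Qed.

Let uniform_seq_mscale (s : seq U) : s != [::] ->
  uniform_seq R s = mscale ((size s)%:R^-1)%:nng (D s).
Proof.
move=> s0; apply/funext => A; rewrite /uniform_seq /mnormalize /mscale/= -/(D s).
have -> : D s setT = ((size s)%:R)%:E.
  by rewrite DE (eq_count (a2 := xpredT)) ?count_predT// => u; exact: mem_set.
by rewrite orbF eqe pnatr_eq0 size_eq0 (negbTE s0) /= muleC.
Qed.

Lemma uniform_seqE (s : seq U) A : s != [::] ->
  uniform_seq R s A = ((count (fun u => u \in A) s)%:R / (size s)%:R)%:E.
Proof. by move=> s0; rewrite uniform_seq_mscale// /mscale/= -/(D s) DE -EFinM mulrC. Qed.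

Lemma ge0_expectation_uniform_seq (s : seq U) (f : U -> R) : s != [::] ->
    measurable_fun setT f -> (forall u, 0 <= f u) ->
  ('E_(uniform_seq R s)[f] = ((\sum_(u <- s) f u) / (size s)%:R)%:E)%E.
Proof.
move=> s0 mf f0; rewrite unlock.
rewrite (eq_measure_integral (mscale ((size s)%:R^-1)%:nng (D s))); last first.
  by move=> A mA _; rewrite /= uniform_seq_mscale.
have /measurable_EFinP mEf := mf.
rewrite ge0_integral_mscale//=; last by move=> u _; rewrite lee_fin.
rewrite ge0_integral_measure_sum//=; last by move=> u _; rewrite lee_fin.
under eq_bigr do rewrite integral_dirac// diracT mul1e.
rewrite sumEFin -EFinM mulrC (big_nth point) big_mkord.
by [].
Qed.

End uniform_lemmas.

Definition eq_law d (U : measurableType d) (R : realType)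
  (mu nu : set U -> \bar R) := forall A, measurable A -> mu A = nu A.

(* Events indexed by a subfamily are covered by taking A j = setT outside it. *)
Definition mutually_independent d d' (T : measurableType d)
    (U : measurableType d') (R : realType) (P : probability T R) n
    (X : 'I_n -> {RV P >-> U}) :=
  forall A : 'I_n -> set U, (forall j, measurable (A j)) ->
    P (\bigcap_j (X j @^-1` A j)) = (\prod_j P (X j @^-1` A j))%E.

(* Convergence in distribution of laws on the line: the distribution functions
   converge at each continuity point of the limit one. *)
Definition cvg_in_law (R : realType) (mu : nat -> set R -> \bar R)
    (nu : set R -> \bar R) :=
  forall x : R, {for x, continuous (fun y : R => nu `]-oo, y]%classic)} ->
    mu n `]-oo, x]%classic @[n --> \oo] --> nu `]-oo, x]%classic.

Section constants.
Context (R : realType) (m : nat).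

Definition logm (x : R) : R := ln x / ln m%:R.

Definition unif1m : probability nat R := uniform_seq R (iota 1 m).

Definition maxX (k : nat) : R := (maxn k (m - k))%:R.

(* The k-th sample point of unif1m being k itself, these are the mean and
   variance of log_m max(X, m - X), and log_m E max(X, m - X), for X uniform on
   {1, ..., m}; truncated subtraction is exact on this range. *)
Definition mu_m : R := fine ('E_unif1m[logm \o maxX])%E.
Definition nu_m : R := fine ('V_unif1m[logm \o maxX])%E.
Definition alpha_m : R := logm (fine ('E_unif1m[maxX])%E).

End constants.

Lemma sum_maxX m :
  (4 * \sum_(k <- iota 1 m) maxn k (m - k) = 3 * m ^ 2 + odd m)%N.
Proof.
elim/ltn_ind: m => -[|[|m]] IH; [by rewrite big_nil|by rewrite big_cons big_nil|].
have -> : iota 1 m.+2 = 1%N :: rcons (map S (iota 1 m)) m.+2.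
  by rewrite -(addn1 m.+1) iotaD -cats1 /= -[2%N]/(1 + 1)%N iotaDl addnC.
rewrite big_cons big_rcons/= big_map.
rewrite (eq_big_seq (fun k => 1 + maxn k (m - k)))%N; last first.
  by move=> k; rewrite mem_iota => /andP[? ?]; lia.
rewrite big_split/= sum1_size size_iota.
by have := IH m (ltnW (leqnn _)); rewrite negbK; nia.
Qed.

Lemma alpha_mE (R : realType) (m : nat) : (2 <= m)%N ->
  (m%:R `^ alpha_m R m)%:E = ('E_(unif1m R m)[@maxX R m])%E /\
  m%:R `^ alpha_m R m = (3 * m%:R ^+ 2 + (m %% 2)%:R) / (4 * m%:R).
Proof.
move=> m2.
have E : ('E_(unif1m R m)[@maxX R m] =
    ((3 * m%:R ^+ 2 + (m %% 2)%:R) / (4 * m%:R))%:E)%E.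
  rewrite ge0_expectation_uniform_seq//; last by case: m m2.
  rewrite -natr_sum size_iota modn2 -!natrX -!natrM -natrD -sum_maxX natrM.
  congr (_%:E); rewrite natrM -mulf_div divff ?mul1r//.
have m0 : 0 < m%:R :> R by rewrite ltr0n (leq_trans _ m2).
suff F : m%:R `^ alpha_m R m = (3 * m%:R ^+ 2 + (m %% 2)%:R) / (4 * m%:R).
  by rewrite E F.
have lm : ln (m%:R : R) != 0 by rewrite gt_eqF// ln_gt0// ltr1n.
rewrite /powR gt_eqF// /alpha_m /logm E/= divfK// lnK// posrE.
by rewrite divr_gt0 ?mulr_gt0// ltr_wpDr// mulr_gt0// exprn_gt0.
Qed.

(* Main.v *)
From HB Require Import structures.
Require Import Defs.
From mathcomp Require Import all_boot all_order all_algebra all_fingroup.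
From mathcomp Require Import all_classical all_reals all_analysis.
From mathcomp Require Import measurable_realfun mxtens ring lra zify.
Import Order.TTheory GRing.Theory Num.Theory.
Import numFieldNormedType.Exports.
Set Implicit Arguments.
Unset Strict Implicit.
Unset Printing Implicit Defensive.

(** The longest increasing subsequence is multiplicative for Kronecker products
    ([lis_kron]), since positions and values of the product are compared
    lexicographically. A power of the m-cycle is a rotation, i.e. two increasing
    blocks with the larger values first, so its longest increasing subsequence is
    the longer block, of length [max(k, m - k)] ([lis_mcycleX]). The Kronecker
    product is injective in its factors ([bigkron_injective]), so a uniform
    butterfly permutation amounts to n independent uniform exponents
    ([perm_enum_butterfly]). This gives the law of the length; as the mean of a
    product of independent factors is the product of the means, it also gives
    the expectation ([avg_lis_butterfly]).

    Taking logarithms, the length becomes a sum of n i.i.d. variables with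
    finitely many values and positive variance ([nu_m_gt0]), and the
    limit is an instance of the central limit theorem, proved here by Stein's
    method ([clt_uniform]). Let [phi] and [Phi] be the density and the
    distribution function of the standard normal law. For a continuous ramp [h]
    that approximates the indicator of a half-line and has Gaussian mean [c],
    the equation [f' - x f = h - c] has an explicit solution; Mills ratio
    ([mills_ratio]) shows that [f'] tends to 0 at both ends, hence that it is
    uniformly continuous ([stein_ramp]). So it suffices that the mean of
    [f' W - W f W] tends to 0 for the normalised sum [W]. Expanding [W f W]
    in one summand at a time, which is independent of the others, leaves an error
    of twice the oscillation of [f'] at the scale of one summand ([stein_sum]),
    and a summand has size of order [1 / sqrt n]. As the variables have finitely
    many values, every expectation in this argument is a finite average. *)

(** * Longest increasing subsequences of butterfly permutations *)

(** An increasing subsequence is encoded by its set of positions rather than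
    by a tuple: products, fibres and projections of such sets are what the
    Kronecker product and the rotations act on. *)
Definition increasing_on N (s : 'S_N) (A : {set 'I_N}) :=
  [forall i in A, forall j in A, (i < j)%N ==> (s i < s j)%N].

Lemma increasing_onP N (s : 'S_N) (A : {set 'I_N}) :
  reflect {in A &, forall i j : 'I_N, (i < j)%N -> (s i < s j)%N}
          (increasing_on s A).
Proof.
apply: (iffP forall_inP) => [H i j iA jA|H i iA].
  by apply/implyP; move/forall_inP: (H i iA); apply.
by apply/forall_inP => j jA; apply/implyP/H.
Qed.

Lemma ltn_ord_trans N : transitive (fun i j : 'I_N => (i < j)%N).
Proof. by move=> j i k; exact: ltn_trans. Qed.

Lemma sorted_enum_set N (A : {set 'I_N}) :
  sorted (fun i j : 'I_N => (i < j)%N) (enum A).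
Proof.
rewrite {1}/enum_mem; apply: sorted_filter; first exact: ltn_ord_trans.
by have := iota_ltn_sorted 0 N; rewrite -val_enum_ord sorted_map enumT.
Qed.

Lemma leq_lis N (s : 'S_N) (A : {set 'I_N}) :
  increasing_on s A -> (#|A| <= lis s)%N.
Proof.
move=> /increasing_onP sA.
have AN : (#|A| < N.+1)%N by rewrite ltnS -[leqRHS]card_ord max_card.
pose t : #|A|.-tuple 'I_N := Tuple (introT eqP (esym (cardE A))).
rewrite /lis; apply: (@leq_bigmax_cond _ _ _ (Ordinal AN)).
apply/existsP; exists t; rewrite /= sorted_enum_set/=.
rewrite sorted_map.
apply: (sub_in_sorted (P := mem A)) (sorted_enum_set A); first exact: sA.
by apply/allP => i; rewrite mem_enum.
Qed.

Lemma lis_attained N (s : 'S_N) : exists2 A, increasing_on s A & #|A| = lis s.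
Proof.
pose p (k : 'I_N.+1) := [exists t : k.-tuple 'I_N,
      sorted (fun i j : 'I_N => (i < j)%N) t &&
      sorted (fun i j : 'I_N => (i < j)%N) (map s t)].
have p0 : (0 < #|p|)%N.
  by apply/card_gt0P; exists ord0; apply/existsP; exists [tuple].
rewrite /lis; have [k pk ->] := eq_bigmax_cond val p0.
have /existsP[t /andP[st sst]] := pk.
have trt := @ltn_ord_trans N.
exists [set i in tval t].
  apply/increasing_onP => i j; rewrite !inE => it jt ij.
  move: sst; rewrite sorted_map => sst.
  have trs : transitive (fun i j : 'I_N => (s i < s j)%N).
    by move=> ? ? ?; exact: ltn_trans.
  have li : (index i t < index j t)%N.
    rewrite ltnNge; apply/negP => ji.
    have : (nth i t (index j t) <= nth i t (index i t))%N.
      move: ji; rewrite leq_eqVlt => /predU1P[->//|ji].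
      apply: ltnW; apply: (sorted_ltn_nth trt i st) => //;
      by rewrite inE index_mem.
    by rewrite !nth_index// leqNgt ij.
  have := sorted_ltn_nth trs i sst; move=> /(_ (index i t) (index j t)).
  by rewrite !inE !index_mem !nth_index//; apply.
rewrite cardsE; have /card_uniqP -> : uniq t; last by rewrite size_tuple.
by apply: (sorted_uniq trt _ st) => i; rewrite ltnn.
Qed.

Lemma lis_le N (s : 'S_N) k :
  (forall A, increasing_on s A -> #|A| <= k)%N -> (lis s <= k)%N.
Proof. by move=> H; have [A sA <-] := lis_attained s; exact: H. Qed.

Lemma ltn_mxtens_index a b (i i' : 'I_a) (j j' : 'I_b) :
  (mxtens_index (i, j) < mxtens_index (i', j'))%N
    = (i < i')%N || (i == i') && (j < j')%N.
Proof.
rewrite /mxtens_index/=.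
have := ltn_ord j; have := ltn_ord j'; rewrite -val_eqE/=; nia.
Qed.

(** Positions of the Kronecker product are pairs in lexicographic order, and so
    are its values. Hence the first coordinates of an increasing set form an
    increasing set for the left factor, and each of its fibres is increasing
    for the right factor; conversely a product of increasing sets is
    increasing. *)
Lemma lis_kron a b (s : 'S_a) (t : 'S_b) : lis (kron s t) = (lis s * lis t)%N.
Proof.
have kE i j : kron s t (mxtens_index (i, j)) = mxtens_index (s i, t j).
  by rewrite permE /kron_fun mxtens_indexK.
apply/eqP; rewrite eqn_leq; apply/andP; split.
  apply: lis_le => A /increasing_onP sA.
  pose A1 := [set (mxtens_unindex k).1 | k in A].
  have s1 : increasing_on s A1.
    apply/increasing_onP => _ _ /imsetP[k kA ->] /imsetP[l lA ->] kl.
    have := sA _ _ kA lA.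
    case: (mxtens_indexP k) kl => i j; case: (mxtens_indexP l) => i' j'.
    rewrite !mxtens_indexK/= => ii'; rewrite !kE !ltn_mxtens_index ii' => /(_ isT).
    rewrite (inj_eq perm_inj) => /orP[//|/andP[/eqP ii]].
    by rewrite ii ltnn in ii'.
  apply: leq_trans (leq_mul (leq_lis s1) (leqnn _)).
  rewrite -sum1_card (partition_big (fun k => (mxtens_unindex k).1) (mem A1));
    last first.
    by move=> k kA; apply/imsetP; exists k.
  rewrite -sum_nat_const; apply: leq_sum => i iA1.
  pose Ai := [set j | mxtens_index (i, j) \in A].
  apply: (@leq_trans #|Ai|).
    rewrite sum1_card -(card_imset Ai (f := fun j => mxtens_index (i, j))).
      apply/subset_leq_card/fintype.subsetP => k; rewrite unfold_in => /andP[].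
      case: (mxtens_indexP k) => i' j; rewrite mxtens_indexK => kA /eqP ii.
      by apply/imsetP; exists j; rewrite ?inE -?ii.
    by move=> j j' /(can_inj (@mxtens_indexK a b)) [].
  apply/leq_lis/increasing_onP => j j'; rewrite !inE => jA jA' jj'.
  have := sA _ _ jA jA'; rewrite !kE !ltn_mxtens_index jj' !eqxx !ltnn/=.
  exact.
have [A sA <-] := lis_attained s; have [B tB <-] := lis_attained t.
rewrite -cardsX -(card_imset (finset.setX A B) (can_inj (@mxtens_indexK a b))).
apply/leq_lis/increasing_onP => k l /imsetP[[i j] ijAB ->{k}].
move=> /imsetP[[i' j'] ijAB' ->{l}].
move: ijAB ijAB'; rewrite !inE/= => /andP[iA jB] /andP[iA' jB'].
rewrite !kE !ltn_mxtens_index => /orP[ii'|/andP[/eqP <- jj']].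
  by rewrite (increasing_onP _ _ sA).
by rewrite eqxx (increasing_onP _ _ tB)// orbT.
Qed.

Lemma lis_cast_perm N N' (e : N = N') (s : 'S_N) : lis (cast_perm e s) = lis s.
Proof. by case: N' / e; rewrite cast_perm_id. Qed.

Lemma lis_bigkron m n (f : 'I_n -> 'S_m) :
  lis (bigkron f) = (\prod_j lis (f j))%N.
Proof.
elim: n f => [|n IH] f /=.
  rewrite big_ord0; apply/eqP; rewrite eqn_leq; apply/andP; split.
    apply: lis_le => A _; apply: leq_trans (max_card _) _.
    by rewrite card_ord expn0.
  apply: leq_trans (leq_lis (A := [set: 'I_(m ^ 0)]) _).
    by rewrite cardsT card_ord expn0.
  by apply/increasing_onP => i j _ _; rewrite !perm1.
by rewrite lis_cast_perm lis_kron IH big_ord_recl.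
Qed.

Lemma mcycleX m k (i : 'I_m) : (mcycle m ^+ k)%g i = (i + k) %% m :> nat.
Proof.
elim: k => [|k IH]; first by rewrite expg0 perm1 addn0 modn_small.
by rewrite expgSr permM permE/= IH -addn1 modnDml addn1 addnS.
Qed.

(** The [k]-th power of the cycle lists [k, ..., m - 1] and then
    [0, ..., k - 1]. Each of the two blocks is increasing, and every value of
    the second is below every value of the first, so an increasing set stays
    inside one block. *)
Lemma lis_mcycleX m k : (k <= m)%N -> lis (mcycle m ^+ k)%g = maxn k (m - k).
Proof.
move=> km; have lem : (m - k <= m)%N by exact: leq_subr.
have him (j : 'I_k) : (j + (m - k) < m)%N by have := ltn_ord j; lia.
pose lo : {set 'I_m} := [set widen_ord lem j | j : 'I_(m - k)].
pose hi : {set 'I_m} := [set Ordinal (him j) | j : 'I_k].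
have clo : #|lo| = (m - k)%N.
  by rewrite card_imset ?card_ord// => i j [] /ord_inj.
have chi : #|hi| = k.
  by rewrite card_imset ?card_ord// => i j [] /addIn /ord_inj.
have inlo i : (i \in lo) = (i < m - k)%N.
  apply/imsetP/idP => [[j _ ->]/=|ik]; first exact: ltn_ord.
  by exists (Ordinal ik) => //; exact/val_inj.
have inhi i : (i \in hi) = (m - k <= i)%N.
  apply/imsetP/idP => [[j _ ->]/=|ik]; first exact: leq_addl.
  have jk : (i - (m - k) < k)%N by have := ltn_ord i; lia.
  by exists (Ordinal jk) => //; apply/val_inj; rewrite /= subnK.
have elo (i : 'I_m) : (i < m - k)%N -> (mcycle m ^+ k)%g i = (i + k)%N :> nat.
  by move=> ?; rewrite mcycleX modn_small//; lia.
have ehi (i : 'I_m) : (m - k <= i)%N ->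
    (mcycle m ^+ k)%g i = (i - (m - k))%N :> nat.
  move=> ik; rewrite mcycleX; have := ltn_ord i => im.
  have -> : (i + k = i - (m - k) + m)%N by lia.
  by rewrite modnDr modn_small//; lia.
apply/eqP; rewrite eqn_leq; apply/andP; split; last first.
  rewrite geq_max -{1}chi -clo; apply/andP.
  split; apply/leq_lis/increasing_onP => i j.
    by rewrite !inhi => ? ? ?; rewrite !ehi//; lia.
  by rewrite !inlo => ? ? ?; rewrite !elo//; lia.
apply: lis_le => A /increasing_onP sA.
have [/subset_leq_card|/fintype.subsetPn[i iA]] := boolP (A \subset lo).
  by rewrite clo => /leq_trans; apply; rewrite leq_maxr.
rewrite inlo -leqNgt => ki.
have [/subset_leq_card|/fintype.subsetPn[j jA]] := boolP (A \subset hi).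
  by rewrite chi => /leq_trans; apply; rewrite leq_maxl.
rewrite inhi -ltnNge => jk.
have := sA j i jA iA; rewrite elo// ehi// => /(_ (leq_trans jk ki)).
by have := ltn_ord i; lia.
Qed.

Lemma kron_injective a b (s s' : 'S_a) (t t' : 'S_b) : (0 < a)%N -> (0 < b)%N ->
  kron s t = kron s' t' -> s = s' /\ t = t'.
Proof.
move=> a0 b0 e.
have E i j : (s i, t j) = (s' i, t' j).
  apply: (can_inj (@mxtens_indexK a b)).
  have := congr1 (fun p : 'S__ => p (mxtens_index (i, j))) e.
  by rewrite !permE /kron_fun !mxtens_indexK.
split; apply/permP => i; first by case: (E i (Ordinal b0)).
by case: (E (Ordinal a0) i).
Qed.

Lemma bigkron_injective m n (f g : 'I_n -> 'S_m) : (0 < m)%N ->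
  bigkron f = bigkron g -> f =1 g.
Proof.
move=> m0; elim: n f g => [|n IH] f g /=; first by move=> _ [].
move=> /(can_inj (cast_permK _)) /kron_injective[//||f0 /IH fg j].
  by rewrite expn_gt0 m0.
by have [i ->|->] := unliftP ord0 j; first exact: fg.
Qed.

Lemma mcycleX_inj m (i j : 'I_m) :
  (mcycle m ^+ i.+1 = mcycle m ^+ j.+1)%g -> i = j.
Proof.
move=> /(congr1 (fun s : 'S_m => nat_of_ord (s i))); rewrite !mcycleX => /eqP.
have m0 : (0 < m)%N by exact: leq_ltn_trans (leq0n i) (ltn_ord i).
rewrite -!addSnnS eqn_modDl (modn_small (ltn_ord i)) (modn_small (ltn_ord j)).
by move=> /eqP /ord_inj.
Qed.

Lemma mcycle_cycleP m (s : 'S_m) : (0 < m)%N ->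
  reflect (exists i : 'I_m, s = mcycle m ^+ i.+1)%g (s \in <[mcycle m]>%g).
Proof.
move=> m0; apply: (iffP (cycleP _ _)) => [[k ->]|[i ->]]; last by exists i.+1.
have im : ((k + m.-1) %% m < m)%N by rewrite ltn_mod.
exists (Ordinal im) => /=; apply/permP => i; apply: ord_inj.
rewrite !mcycleX /= -addSnnS [(i.+1 + _)%N]addnC modnDml.
have -> : (k + m.-1 + i.+1 = i + k + m)%N by lia.
by rewrite modnDr.
Qed.

(** The exponents are taken in {1, ..., m} rather than in {0, ..., m - 1}, so
    that the exponent is directly the sample point of the uniform variable on
    {1, ..., m}; exponent m stands for the identity. *)
Definition butterfly_elt m n (w : {ffun 'I_n -> 'I_m}) : 'S_(m ^ n) :=
  bigkron (fun j => mcycle m ^+ (w j).+1)%g.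

(** As the Kronecker product of permutations is injective in its factors, a
    butterfly permutation is the same as a choice of n independent exponents:
    averages over the group are averages over exponent vectors. *)
Lemma perm_enum_butterfly m n : (0 < m)%N ->
  perm_eq (enum (butterfly m n))
          (map (@butterfly_elt m n) (enum {: {ffun 'I_n -> 'I_m}})).
Proof.
move=> m0; apply: uniq_perm; first exact: enum_uniq.
  rewrite map_inj_uniq ?enum_uniq// => w w' /(bigkron_injective m0) ww.
  by apply/ffunP => j; apply: mcycleX_inj; exact: ww.
move=> s; rewrite mem_enum; apply/imsetP/mapP => [[f /ffun_onP fm ->]|[w _ ->]].
  have /fin_all_exists[w fw] : forall j,
      exists i : 'I_m, f j = (mcycle m ^+ i.+1)%g.
    by move=> j; exact/mcycle_cycleP/fm.
  exists (finfun w); first by rewrite mem_enum.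
  by congr bigkron; apply/funext => j; rewrite fw ffunE.
exists [ffun j => (mcycle m ^+ (w j).+1)%g].
  by apply/ffun_onP => j; rewrite ffunE; apply/mcycle_cycleP => //; exists (w j).
by congr bigkron; apply/funext => j; rewrite ffunE.
Qed.

Lemma lis_butterfly_elt m n (w : {ffun 'I_n -> 'I_m}) :
  lis (butterfly_elt w) = (\prod_j maxn (w j).+1 (m - (w j).+1))%N.
Proof. by rewrite lis_bigkron; apply: eq_bigr => j _; exact: lis_mcycleX. Qed.

Local Open Scope classical_set_scope.
Local Open Scope ring_scope.

(** * Calculus on the real line *)

Section calculus.
Context {R : realType}.

Lemma is_derive_ge0_le (f df : R -> R) (x y : R) : x <= y ->
  (forall z, x <= z <= y -> is_derive z 1 f (df z)) ->
  (forall z, x <= z <= y -> 0 <= df z) -> f x <= f y.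
Proof.
move=> xy fd df0; have sub z : z \in `]x, y[ -> x <= z <= y.
  by rewrite in_itv/= => /andP[/ltW -> /ltW ->].
have [||z] := @MVT_segment R f df x y xy.
- by move=> z /sub; exact: fd.
- apply: derivable_within_continuous => z; rewrite in_itv/= => zxy.
  by case: (fd z zxy).
rewrite in_itv/= => zxy /eqP; rewrite subr_eq => /eqP ->.
by rewrite lerDr mulr_ge0 ?subr_ge0// df0.
Qed.

Lemma is_derive_le0_cvg0_ge0 (f df : R -> R) (x : R) :
  (forall z, x <= z -> is_derive z 1 f (df z)) ->
  (forall z, x <= z -> df z <= 0) -> f z @[z --> +oo] --> 0 -> 0 <= f x.
Proof.
move=> fd df0 f0; apply: (cvgr_to_le f0); near=> y.
have xy : x <= y by near: y; apply: nbhs_pinfty_ge; rewrite num_real.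
rewrite -lerN2; apply: (@is_derive_ge0_le (fun z => - f z) (fun z => - df z)) => //
  z /andP[xz _].
  by have := fd z xz => ?; exact: is_deriveN.
by rewrite oppr_ge0 df0.
Unshelve. all: by end_near. Qed.

(** First-order Taylor bound in terms of the oscillation of the derivative:
    the mean value theorem applied to [v |-> f (z + v) - v * f' z]. *)
Lemma taylor1_le (f f' : R -> R) (d e z u : R) :
  (forall x : R, is_derive x 1 f (f' x)) ->
  (forall x u, `|u| <= d -> `|f' (x + u) - f' x| <= e) ->
  `|u| <= d -> `|f (z + u) - f z - u * f' z| <= `|u| * e.
Proof.
move=> df uf' ud; pose g v := f (z + v) - v * f' z.
have dg (v : R) : is_derive v 1 g (f' (z + v) - f' z).
  have d1 := df (z + v).
  have d2 : is_derive v 1 (fun v => f (z + v)) (f' (z + v)).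
    have d0 := is_derive_shift v 1 z; rewrite addrC in d1.
    have := @is_derive1_comp _ f (shift z) v _ 1 d1 d0.
    rewrite mulr1 addrC; congr is_derive.
    by apply/funext => t /=; rewrite addrC.
  by apply: is_derive_eq; rewrite /GRing.scale/= mulr0 mulr1 add0r.
have -> : f (z + u) - f z - u * f' z = g u - g 0.
  by rewrite /g addr0 mul0r subr0 addrAC.
have cg s t : {within `[s, t], continuous g}.
  by apply: derivable_within_continuous => v _; case: (dg v).
have [u0|/ltW u0] := leP 0 u.
  have [v + ->] := MVT_segment u0 (fun v _ => dg v) (cg _ _).
  rewrite in_itv/= subr0 normrM mulrC => /andP[v0 vu].
rewrite ler_wpM2l// uf'//.
  by apply: le_trans ud; rewrite !ger0_norm// (le_trans v0).
rewrite distrC; have [v + ->] := MVT_segment u0 (fun v _ => dg v) (cg _ _).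
rewrite in_itv/= sub0r normrM normrN mulrC => /andP[v0 vu].
rewrite ler_wpM2l// uf'//.
by apply: le_trans ud; rewrite !ler0_norm// lerN2.
Qed.

Lemma cvgV_y : x^-1 @[x --> +oo] --> (0 : R).
Proof.
apply/gtr0_cvgV0; last by apply: cvg_id.
by near=> x; near: x; apply: nbhs_pinfty_gt; rewrite num_real.
Unshelve. all: by end_near. Qed.

(** Far out, both values are small because of the limits at infinity; on the
    remaining compact interval, Heine's argument applies. *)
Lemma continuous_cvg0_unif_continuous (f : R -> R) (e : R) :
  continuous f -> f x @[x --> +oo] --> (0 : R) -> f x @[x --> -oo] --> (0 : R) ->
  0 < e -> exists2 d, 0 < d & forall x u, `|u| <= d -> `|f (x + u) - f x| <= e.
Proof.
move=> cf fy fNy e0; have e20 : 0 < e / 2 by rewrite divr_gt0.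
have [M M0 fM] : exists2 M, 0 < M & forall x, M <= `|x| -> `|f x| <= e / 2.
  have Ny : \forall M \near +oo, `|f (- M)| <= e / 2.
    have := (cvgNy_compNP f _).1 fNy => /cvgr0Pnorm_le; exact.
  have Py : \forall M \near +oo, `|f M| <= e / 2 by move/cvgr0Pnorm_le : fy; exact.
  have [M1 [_ HM1]] := Ny; have [M2 [_ HM2]] := Py.
  exists (Num.max 0 (Num.max M1 M2) + 1); first by rewrite ltr_wpDl// le_max lexx.
  move=> x; have [x0|x0] := leP 0 x.
    rewrite ger0_norm// => Mx; apply: HM2.
    by apply: lt_le_trans Mx; rewrite ltr_pwDr// !le_max lexx !orbT.
  rewrite ltr0_norm// => Mx; rewrite -(opprK x); apply: HM1.
  by apply: lt_le_trans Mx; rewrite ltr_pwDr// !le_max lexx !orbT.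
(* The margin 1 around [-M, M] absorbs every displacement of size at most 1. *)
have /compact_near_coveringP cK := @segment_compact R (- (M + 1)) (M + 1).
have nc x : x \in `[- (M + 1), M + 1] ->
    \forall x' \near x & d \near 0^'+,
      forall u, `|u| <= d -> `|f (x' + u) - f x'| <= e.
  move=> _; have := cf x => /cvgrPdist_lt /(_ _ e20) [r /= r0 fr].
  exists (ball x (r / 2), [set d | d < r / 2]) => /=.
    split; first by apply: nbhsx_ballx; rewrite divr_gt0.
    by apply: nbhs_right_lt; rewrite divr_gt0.
  move=> [x' d] /= [xx' dr] u ud.
  have h1 : `|f x - f x'| < e / 2.
    apply: fr; rewrite /ball_/=; apply: lt_trans xx' _.
    by rewrite ltr_pdivrMr// ltr_pMr// ltr1n.
  have h2 : `|f x - f (x' + u)| < e / 2.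
    apply: fr; rewrite /ball_/= opprD addrA.
    rewrite (le_lt_trans (ler_normB _ _))// [ltRHS]splitr ltrD//.
    exact: le_lt_trans dr.
  have -> : f (x' + u) - f x' = (f x - f x') - (f x - f (x' + u)) by ring.
  by rewrite [e]splitr (le_trans (ler_normB _ _))// lerD// ltW.
have [d /= d0 Hd] := cK _ _ _ _ nc.
exists (Num.min 1 (d / 2)); first by rewrite lt_min ltr01 divr_gt0.
move=> x u; rewrite le_min => /andP[u1 ud].
have [xM|xM] := leP `|x| (M + 1).
  apply: (Hd (d / 2)) => //=; rewrite ?divr_gt0//.
    by rewrite sub0r normrN gtr0_norm ?divr_gt0// ltr_pdivrMr// ltr_pMr// ltr1n.
  by rewrite in_itv/= -ler_norml.
rewrite [e]splitr; apply: le_trans (ler_normB _ _) _; apply: lerD; apply: fM.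
  rewrite -[leLHS](addrK 1) lerBlDr; apply: le_trans (ltW xM) _.
  rewrite -{1}(addrK u x); apply: le_trans (ler_normB _ _) _.
  exact: lerD.
by apply: le_trans (ltW xM); rewrite lerDl.
Qed.

End calculus.

(** * The standard normal distribution function *)

Section gauss.
Context {R : realType}.
Local Notation phi := (@normal_pdf R 0 1).

Definition Phi (x : R) : R := fine (normal_prob (0 : R) 1 `]-oo, x]%classic).

Lemma PhiE x : (Phi x)%:E = normal_prob 0 1 `]-oo, x]%classic :> \bar R.
Proof. by rewrite fineK// fin_num_measure. Qed.

Lemma std_normal_pdf_gt0 x : 0 < phi x.
Proof.
by rewrite normal_pdfE ?oner_neq0// mulr_gt0 ?expR_gt0 ?normal_peak_gt0 ?oner_neq0.
Qed.

Lemma is_derive_std_normal_pdf (x : R) : is_derive x 1 phi (- x * phi x).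
Proof.
rewrite normal_pdfE ?oner_neq0// /normal_fun.
apply: is_derive_eq.
rewrite !scaler0 /GRing.scale/= expr1n; by field.
Qed.

Lemma is_derive_std_normal_pdfV (x : R) :
  is_derive x 1 (fun y => (phi y)^-1) (x * (phi x)^-1).
Proof.
have p0 : phi x != 0 by rewrite gt_eqF// std_normal_pdf_gt0.
have [dp ep] := is_derive_std_normal_pdf x.
apply: DeriveDef; first exact: derivableV.
by rewrite deriveV// ep /GRing.scale/=; field.
Qed.

Lemma is_derive_Phi (x : R) : is_derive x 1 Phi (phi x).
Proof.
have [d e] : derivable Phi x 1 /\ (derive1 Phi) x = phi x.
  apply: (@continuous_FTC1 _ phi -oo%O x (x + 1)) => //.
  - by rewrite ltrDl.
  - by apply: (integrableS _ _ (@subsetT _ _)) => //; exact: integrable_normal_pdf.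
  - by rewrite ltNyr.
  - exact: (@continuous_normal_pdf R 0 1 (oner_neq0 _) x).
by apply: DeriveDef => //; rewrite -derive1E.
Qed.

(* The identity is declared as a random variable, so that the limits of its
   distribution function apply to Phi. *)
Let idR : measurableTypeR R -> R := idfun.
#[local] HB.instance Definition _ :=
  @isMeasurableFun.Build _ _ _ _ idR (@measurable_id _ _ setT).

Let PhiE_cdf : Phi = fine \o cdf (idR : {RV (normal_prob (0 : R) 1) >-> R}).
Proof. by []. Qed.

Lemma cvg_Phi_y : Phi x @[x --> +oo] --> (1 : R).
Proof. by rewrite PhiE_cdf; apply/fine_cvg; exact: cvg_cdfy1. Qed.

Lemma cvg_Phi_Ny : Phi x @[x --> -oo] --> (0 : R).
Proof. by rewrite PhiE_cdf; apply/fine_cvg; exact: cvg_cdfNy0. Qed.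

(** Mills ratio. For [x > 0] one has
    [phi x * (1/x - 1/x^3) <= F x <= phi x / x]: both differences tend to 0 at
    infinity and, by [phi' = - x phi], have a derivative of constant sign.
    The function [F] is kept abstract because it is used both for the upper
    tail [1 - Phi x] and for the lower tail [Phi (- x)]. *)
Lemma mills_ratio (F : R -> R) : (forall x : R, is_derive x 1 F (- phi x)) ->
  F x @[x --> +oo] --> 0 -> x * F x / phi x @[x --> +oo] --> (1 : R).
Proof.
move=> dF F0.
have ppos x := std_normal_pdf_gt0 x.
have dV (x : R) : 0 < x -> is_derive x 1 (fun y : R => y^-1) (- x^-1 ^+ 2).
  move=> x0; apply: DeriveDef; first by apply: derivableV; rewrite ?gt_eqF.
  by rewrite deriveV ?gt_eqF// derive_id /GRing.scale/= mulr1 exprVn.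
have p0 : phi x * x^-1 @[x --> +oo] --> 0.
  apply: (@squeeze_cvgr _ _ _ _ (cst 0) (fun x => normal_peak 1 * x^-1)); first last.
  - by rewrite -[X in _ --> X](mulr0 (normal_peak 1)); apply: cvgMr; exact: cvgV_y.
  - exact: cvg_cst.
  near=> x; have x0 : 0 < x by near: x; apply: nbhs_pinfty_gt; rewrite num_real.
  apply/andP; split; first by rewrite mulr_ge0 ?invr_ge0 ?ltW.
  by rewrite ler_pM2r ?invr_gt0// normal_pdf_ub ?oner_neq0.
have up (x : R) : 0 < x -> F x <= phi x * x^-1.
  move=> x0; rewrite -subr_ge0.
  apply: (@is_derive_le0_cvg0_ge0 R (fun x => phi x * x^-1 - F x)
    (fun z => - (phi z * z^-1 ^+ 2))).
  - move=> z xz; have z0 : 0 < z by exact: lt_le_trans xz.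
    have := dV z z0; have := dF z; have := is_derive_std_normal_pdf z => d1 d2 d3.
    apply: is_derive_eq; rewrite /GRing.scale/=.
    by field; rewrite gt_eqF.
  - move=> z xz; have z0 : 0 < z by exact: lt_le_trans xz.
    by rewrite oppr_le0 mulr_ge0 ?exprn_ge0 ?invr_ge0 ?ltW.
  - by rewrite -[X in _ --> X](subrr 0); exact: cvgB.
have lo (x : R) : 0 < x -> phi x * (x^-1 - x^-1 ^+ 3) <= F x.
  move=> x0; rewrite -subr_ge0.
  apply: (@is_derive_le0_cvg0_ge0 R (fun x => F x - phi x * (x^-1 - x^-1 ^+ 3))
    (fun z => - (phi z * 3 * z^-1 ^+ 4))).
  - move=> z xz; have z0 : 0 < z by exact: lt_le_trans xz.
    have := dV z z0; have := dF z; have := is_derive_std_normal_pdf z => d1 d2 d3.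
    apply: is_derive_eq; rewrite /GRing.scale/=.
    by field; rewrite gt_eqF.
  - move=> z xz; have z0 : 0 < z by exact: lt_le_trans xz.
    by rewrite oppr_le0 !mulr_ge0 ?exprn_ge0 ?invr_ge0 ?ltW.
  - rewrite -[X in _ --> X](subr0 0); apply: cvgB => //.
    have -> : (fun x : R => phi x * (x^-1 - x^-1 ^+ 3)) =
      (fun x : R => (phi x * x^-1) * (1 - x^-1 * x^-1)).
      by apply/funext => y; ring.
    rewrite -[X in _ --> X](mul0r (1 - 0 * 0)); apply: cvgM => //.
    by apply: cvgB; [exact: cvg_cst|apply: cvgM; exact: cvgV_y].
apply: (@squeeze_cvgr _ _ _ _ (fun x => 1 - x^-1 * x^-1) (cst 1)); first last.
- exact: cvg_cst.
- rewrite -[X in _ --> X](subr0 1) -[X in 1 - X](mul0r 0).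
  by apply: cvgB; [exact: cvg_cst|apply: cvgM; exact: cvgV_y].
near=> x; have x0 : 0 < x by near: x; apply: nbhs_pinfty_gt; rewrite num_real.
rewrite ler_pdivlMr// ler_pdivrMr//=; apply/andP; split.
  have := lo x x0; rewrite -(ler_pM2l x0); apply: le_trans.
  by rewrite le_eqVlt; apply/orP; left; apply/eqP; field; rewrite gt_eqF.
have := up x x0; rewrite -(ler_pM2l x0) => /le_trans; apply.
by rewrite mulrCA divff ?gt_eqF// mulr1 mul1r.
Unshelve. all: by end_near. Qed.

End gauss.

(** * Stein's equation *)

Section stein.
Context {R : realType}.
Local Notation phi := (@normal_pdf R 0 1).
Local Notation Phi := (@Phi R).
Local Notation mu := (@lebesgue_measure R).

(** The ratio [(b - x) / (b - a)] clamped to [0, 1]: a continuous version of the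
    indicator of a half-line, 1 up to [a] and 0 from [b] on. The clamping is
    written with absolute values, whose continuity is immediate. *)
Definition ramp (a b x : R) : R :=
  let t := (b - x) / (b - a) in (1 + `|t| - `|t - 1|) / 2.

Lemma ramp_itv a b x : 0 <= ramp a b x <= 1.
Proof.
rewrite /ramp; set t := (b - x) / (b - a).
by have := lerB_dist t 1; have := ler_normB t 1; rewrite normr1; lra.
Qed.

Lemma ramp1 a b x : a < b -> x <= a -> ramp a b x = 1.
Proof.
move=> ab xa; have h : 1 <= (b - x) / (b - a).
  by rewrite ler_pdivlMr ?subr_gt0// mul1r lerD2l lerN2.
rewrite /ramp ger0_norm ?(le_trans ler01)// ger0_norm ?subr_ge0//.
by field; rewrite subr_eq0 gt_eqF.
Qed.

Lemma ramp0 a b x : a < b -> b <= x -> ramp a b x = 0.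
Proof.
move=> ab bx; have h : (b - x) / (b - a) <= 0.
  by rewrite ler_pdivrMr ?subr_gt0// mul0r subr_le0.
rewrite /ramp ler0_norm// ler0_norm ?subr_le0 ?(le_trans h)//.
by field; rewrite subr_eq0 gt_eqF.
Qed.

Lemma continuous_ramp a b : continuous (ramp a b).
Proof.
move=> x; have t : (b - y) / (b - a) @[y --> x] --> (b - x) / (b - a).
  by apply: cvgMl; apply: cvgB; [exact: cvg_cst|exact: cvg_id].
apply: cvgMl; apply: cvgB.
  by apply: cvgD; [exact: cvg_cst|exact: cvg_norm].
by apply: cvg_norm; apply: cvgB => //; exact: cvg_cst.
Qed.

Section solution.
Variables (a b : R).
Hypothesis ab : a < b.
Let h := ramp a b.
Let A x : R := \int[mu]_(t in `]-oo, x]) (h t * phi t).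

Let phi_gt0 := @std_normal_pdf_gt0 R.

Let is_derive_A (x : R) : is_derive x 1 A (h x * phi x).
Proof.
have cp : continuous phi := @continuous_normal_pdf R 0 1 (oner_neq0 _).
have chp : continuous (fun t => h t * phi t).
  by move=> t; apply: cvgM; [exact: continuous_ramp|exact: cp].
have [d e] : derivable A x 1 /\ derive1 A x = h x * phi x.
  apply: (@continuous_FTC1 _ (fun t => h t * phi t) -oo%O x (x + 1)) => //.
  - by rewrite ltrDl.
  - apply: (integrableS _ _ (@subsetT _ _)) => //.
    apply: (le_integrable _ _ _ (@integrable_normal_pdf R 0 1)) => //.
      by apply/measurable_EFinP; exact: continuous_measurable_fun.
    move=> t _; rewrite /= lee_fin normrM ler_piMl//.
    by have /andP[h0 h1] := ramp_itv a b t; rewrite ger0_norm.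
  - by rewrite ltNyr.
  - exact: chp.
by apply: DeriveDef => //; rewrite -derive1E.
Qed.

Let A_lo x : x <= a -> A x = Phi x.
Proof.
move=> xa; congr fine; apply: eq_integral => t /set_mem/=.
by rewrite in_itv/= => tx; rewrite /h ramp1 ?mul1r// (le_trans tx).
Qed.

(* This is the Gaussian mean of h: A is constant from b on. *)
Let c := A b.

Let A_hi x : b <= x -> A x = c.
Proof.
move=> bx; have hz z : b <= z <= x -> h z * phi z = 0.
  by move=> /andP[bz _]; rewrite /h ramp0 ?mul0r.
apply/eqP; rewrite eq_le; apply/andP; split.
  rewrite -lerN2; apply: (@is_derive_ge0_le _ (fun z => - A z)
    (fun z => - (h z * phi z))) => // z zbx.
    by have := is_derive_A z => ?; exact: is_deriveN.
  by rewrite hz ?oppr0.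
apply: (@is_derive_ge0_le _ A (fun z => h z * phi z)) => // z zbx.
by rewrite hz.
Qed.

Let c_ge : Phi a <= c.
Proof.
rewrite -A_lo//; apply: (@is_derive_ge0_le _ A (fun z => h z * phi z));
  rewrite ?ltW// => z _.
by have /andP[h0 _] := ramp_itv a b z; rewrite mulr_ge0 // ltW.
Qed.

Let c_le : c <= Phi b.
Proof.
rewrite -subr_ge0 -(subrr (Phi a)) -{2}(A_lo (lexx a)).
apply: (@is_derive_ge0_le _ (fun z => Phi z - A z)
  (fun z => phi z - h z * phi z)); rewrite ?ltW//.
  by move=> z _; have := is_derive_Phi z => ?; exact: is_deriveB.
move=> z _; have /andP[_ h1] := ramp_itv a b z.
by rewrite subr_ge0 ler_piMl// ltW.
Qed.

Let g x := (A x - c * Phi x) / phi x.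
Let G x := x * g x + (h x - c).

Let is_derive_g (x : R) : is_derive x 1 g (G x).
Proof.
have d1 := is_derive_Phi x; have d2 := is_derive_std_normal_pdfV x.
have d3 := is_derive_A x.
apply: is_derive_eq; rewrite /GRing.scale/= /G /g.
by field; rewrite gt_eqF.
Qed.

(* From b on, A - c Phi is c (1 - Phi), so Mills ratio cancels the constant. *)
Let G_y : G x @[x --> +oo] --> 0.
Proof.
have M : x * (1 - Phi x) / phi x @[x --> +oo] --> (1 : R).
  apply: (mills_ratio (F := fun x => 1 - Phi x)) => [x|].
    by have d := is_derive_Phi x; apply: is_derive_eq; rewrite add0r mul1r.
  by rewrite -[X in _ --> X](subrr (1 : R));
    apply: cvgB; [exact: cvg_cst|exact: cvg_Phi_y].
have L : c * (x * (1 - Phi x) / phi x) - c @[x --> +oo] --> (0 : R).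
  rewrite -[X in _ --> X](subrr c) -[X in _ --> X - _](mulr1 c).
  by apply: cvgD; [exact: cvgMr|exact: cvg_cst].
apply: cvg_trans L; apply: near_eq_cvg; near=> x.
have bx : b <= x by near: x; apply: nbhs_pinfty_ge; rewrite num_real.
by rewrite /G /g A_hi// /h ramp0//; ring.
Unshelve. all: by end_near. Qed.

(* Up to a, A - c Phi is (1 - c) Phi; the reflection x |-> - x brings the lower
   tail to the upper one. *)
Let G_Ny : G x @[x --> -oo] --> 0.
Proof.
have M : x * Phi (- x) / phi x @[x --> +oo] --> (1 : R).
  apply: (mills_ratio (F := fun x => Phi (- x))) => [x|].
    have d := is_derive_Phi (- x).
    have := @is_derive1_comp _ Phi (fun x => - x) x _ _ d (is_deriveNid _ _).
    suff -> : phi x = phi (- x) by rewrite mulrN1.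
    by rewrite normal_pdfE ?oner_neq0// /normal_fun !subr0 sqrrN.
  exact: (cvgNy_compNP _ _).1 cvg_Phi_Ny.
apply/cvgNy_compNP.
have L : (c - 1) * (x * Phi (- x) / phi x) + (1 - c) @[x --> +oo] --> (0 : R).
  rewrite -[X in _ --> X](subrr (c - 1)) -[X in _ --> X - _](mulr1 (c - 1)) opprB.
  by apply: cvgD; [exact: cvgMr|exact: cvg_cst].
apply: cvg_trans L; apply: near_eq_cvg; near=> x.
have xa : - x <= a.
  by rewrite lerNl; near: x; apply: nbhs_pinfty_ge; rewrite num_real.
have -> : phi x = phi (- x).
  by rewrite normal_pdfE ?oner_neq0// /normal_fun !subr0 sqrrN.
by rewrite /= /G /g A_lo// /h ramp1//; ring.
Unshelve. all: by end_near. Qed.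

(** Stein's equation [f' - x f = h - c] for a ramp [h] with Gaussian mean [c].
    Its solution is [f = (A - c Phi) / phi], where [A] is the integral of
    [h * phi] from minus infinity. The derivative is continuous, and tends to 0
    at both ends by Mills ratio, whence its uniform continuity: this is all
    the regularity used below, in place of the usual bound on [f'']. *)
Lemma stein_ramp : exists (f f' : R -> R) (c : R),
  [/\ Phi a <= c <= Phi b,
      forall x : R, is_derive x 1 f (f' x),
      forall x, f' x - x * f x = ramp a b x - c &
      forall e, 0 < e -> exists2 d, 0 < d &
        forall x u, `|u| <= d -> `|f' (x + u) - f' x| <= e].
Proof.
exists g, G, c; split => //.
- by rewrite c_ge c_le.
- by move=> x; rewrite /G addrAC subrr add0r.
move=> e e0; apply: continuous_cvg0_unif_continuous => //.
move=> x; apply: cvgD.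
  apply: cvgM; first exact: cvg_id.
  apply: differentiable_continuous; apply/derivable1_diffP.
  by case: (is_derive_g x).
by apply: cvgB; [exact: continuous_ramp|exact: cvg_cst].
Qed.

End solution.
End stein.

(** * Averages over finite product spaces *)

(** The expectation under the uniform law on a finite type. On
    [{ffun 'I_n -> I}] the coordinates are then i.i.d. uniform on [I]. *)
Definition avg {R : realType} (T : finType) (F : T -> R) : R :=
  (\sum_t F t) / #|T|%:R.

Section avg.
Context {R : realType} (T : finType).
Implicit Types F G : T -> R.

Lemma le_avg F G : (forall t, F t <= G t) -> avg F <= avg G.
Proof.
by move=> FG; rewrite /avg ler_wpM2r ?invr_ge0//; apply: ler_sum.
Qed.

Lemma avgB F G : avg (fun t => F t - G t) = avg F - avg G.
Proof. by rewrite /avg sumrB mulrBl. Qed.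

Lemma avg_cst (c : R) : (0 < #|T|)%N -> avg (fun _ : T => c) = c.
Proof.
move=> T0; rewrite /avg sumr_const -(mulr_natr c) mulfK// pnatr_eq0.
by rewrite -lt0n.
Qed.

End avg.

Definition update n (I : finType) (w : {ffun 'I_n -> I}) (i : 'I_n) (u : I) :
  {ffun 'I_n -> I} := [ffun j => if j == i then u else w j].

(** Resampling one coordinate: replacing coordinate [i] by an independent fresh
    draw does not change the mean, because exchanging the old value with the
    fresh one is an involution. *)
Lemma sum_resample {R : realType} n (I : finType) (i : 'I_n)
    (F : {ffun 'I_n -> I} -> R) :
  \sum_w \sum_u F (update w i u) = #|I|%:R * \sum_w F w.
Proof.
pose th (p : {ffun 'I_n -> I} * I) := (update p.1 i p.2, p.1 i).
have thK : involutive th.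
  move=> [w u]; rewrite /th /=; congr pair; last by rewrite ffunE eqxx.
  by apply/ffunP => j; rewrite !ffunE; case: eqP => // ->.
rewrite pair_bigA/=.
transitivity (\sum_(p : {ffun 'I_n -> I} * I) F p.1).
  by rewrite [RHS](reindex_inj (inv_inj thK)).
rewrite -(pair_bigA _ (fun w u => F w))/= mulr_sumr; apply: eq_bigr => w _.
by rewrite sumr_const mulr_natl.
Qed.

Section stein_sum.
Context {R : realType} (I : finType) (y : I -> R) (n : nat).
Hypothesis I0 : (0 < #|I|)%N.
Hypothesis y_mean0 : \sum_u y u = 0.
Hypothesis y_var1 : \sum_u y u ^+ 2 = #|I|%:R.
Variables (f f' : R -> R) (d e : R).
Hypothesis df : forall x : R, is_derive x 1 f (f' x).
Hypothesis uf' : forall x u, `|u| <= d -> `|f' (x + u) - f' x| <= e.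

(* The scale s is the normalisation 1 / sqrt n of the sum. *)
Variable s : R.
Hypothesis sn : n%:R * s ^+ 2 = 1.
Hypothesis yd : forall u, `|s * y u| <= d.
Local Notation Omega := {ffun 'I_n -> I}.
Let W (w : Omega) : R := \sum_j s * y (w j).

(** Write [W = Wi + s y(w i)] with [Wi] independent of coordinate [i]. Resampling
    that coordinate, the mean of [s y(w i) f W] expands around [Wi]: the term of
    order 0 vanishes as [y] is centred, the term of order 1 is [s^2 f' Wi] as [y]
    has variance 1, and replacing [f' Wi] by [f' W] costs one more oscillation
    of [f']. *)
Lemma stein_coord (i : 'I_n) :
  `|\sum_(w : Omega) (s * y (w i) * f (W w) - s ^+ 2 * f' (W w))|
    <= #|Omega|%:R * (s ^+ 2 * (2 * e)).
Proof.
pose Wi (w : Omega) := \sum_(j | j != i) s * y (w j).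
have WE w : W w = Wi w + s * y (w i).
  by rewrite /W (bigD1 i)//= addrC.
have WiU w u : Wi (update w i u) = Wi w.
  by apply: eq_bigr => j /negbTE ji; rewrite ffunE ji.
have WU w u : W (update w i u) = Wi w + s * y u.
  by rewrite WE WiU ffunE eqxx.
have K0 : 0 < #|I|%:R :> R by rewrite ltr0n.
have inner (w : Omega) :
    `|\sum_u (s * y u * f (Wi w + s * y u) - s ^+ 2 * f' (Wi w + s * y u))|
    <= #|I|%:R * (s ^+ 2 * (2 * e)).
  set z := Wi w.
  have e0 : 0 <= e by case/card_gt0P: I0 => u _; apply: le_trans (uf' 0 (yd u)).
  (* Centring and unit variance allow subtracting the Taylor polynomial. *)
  have -> : \sum_u (s * y u * f (z + s * y u) - s ^+ 2 * f' (z + s * y u)) =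
     \sum_u (s * y u * (f (z + s * y u) - f z - s * y u * f' z)
              - s ^+ 2 * (f' (z + s * y u) - f' z)).
    apply/eqP; rewrite -subr_eq0 -sumrB; apply/eqP.
    rewrite (eq_bigr (fun u => s * f z * y u + s ^+ 2 * f' z * (y u ^+ 2 - 1))).
      rewrite big_split/= -!mulr_sumr y_mean0 sumrB y_var1 sumr_const.
      by rewrite subrr !mulr0 addr0.
    by move=> u _; ring.
  apply: le_trans (ler_norm_sum _ _ _) _.
  apply: (@le_trans _ _ (\sum_u ((s * y u) ^+ 2 * e + s ^+ 2 * e))).
    apply: ler_sum => u _; apply: le_trans (ler_normB _ _) _; apply: lerD.
      rewrite normrM -(real_normK (num_real (s * y u))) expr2 -[leRHS]mulrA.
      rewrite ler_wpM2l//.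
      exact: (taylor1_le z df uf').
    by rewrite normrM ger0_norm ?sqr_ge0// ler_wpM2l ?sqr_ge0// uf'.
  have sy2 : \sum_u (s * y u) ^+ 2 = s ^+ 2 * #|I|%:R.
    by rewrite -y_var1 mulr_sumr; apply: eq_bigr => u _; rewrite exprMn.
  rewrite big_split/= -mulr_suml sy2 sumr_const -(mulr_natl (s ^+ 2 * e)).
  rewrite le_eqVlt; apply/orP; left; apply/eqP.
  by ring.
rewrite -(ler_pM2l K0) -{1}(ger0_norm (ltW K0)) -normrM -(sum_resample i).
apply: le_trans (ler_norm_sum _ _ _) _.
rewrite mulrCA (mulr_natl (#|I|%:R * _)) -(sumr_const Omega).
apply: ler_sum => w _.
apply: le_trans (inner w); rewrite le_eqVlt; apply/orP; left; apply/eqP.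
by congr (`|_|); apply: eq_bigr => u _; rewrite WU ffunE eqxx.
Qed.

Lemma stein_sum :
  `|avg (fun w : Omega => f' (W w) - W w * f (W w))| <= 2 * e.
Proof.
have O0 : 0 < #|Omega|%:R :> R by rewrite ltr0n card_ffun expn_gt0 I0.
rewrite /avg normrM normfV (gtr0_norm O0) ler_pdivrMr// -normrN -sumrN.
have -> : \sum_w - (f' (W w) - W w * f (W w)) =
    \sum_i \sum_(w : Omega) (s * y (w i) * f (W w) - s ^+ 2 * f' (W w)).
  rewrite exchange_big/=; apply: eq_bigr => w _.
  rewrite sumrB -mulr_suml sumr_const card_ord -mulrnAl -(mulr_natl (s ^+ 2)) sn.
  by rewrite mul1r opprB.
apply: le_trans (ler_norm_sum _ _ _) _.
apply: le_trans (ler_sum _ (fun i _ => stein_coord i)) _.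
rewrite sumr_const card_ord -(mulr_natl (#|Omega|%:R * _)).
by rewrite mulrCA (mulrA n%:R) sn mul1r mulrC.
Qed.

End stein_sum.

(** * The central limit theorem *)

Section clt.
Context {R : realType} (I : finType) (y : I -> R).
Hypothesis I0 : (0 < #|I|)%N.
Hypothesis y_mean0 : \sum_u y u = 0.
Hypothesis y_var1 : \sum_u y u ^+ 2 = #|I|%:R.
Let W n (w : {ffun 'I_n -> I}) : R := (\sum_j y (w j)) / Num.sqrt n%:R.

(** The mean of [ramp a b (W w)] minus the constant [c] of Stein's equation is the
    mean of [f' W - W f W], at most twice the oscillation of [f'] at the scale
    of the summands; these are uniformly of order [1 / sqrt n]. *)
Lemma avg_ramp_near a b e : a < b -> 0 < e ->
  \forall n \near \oo,
    Phi a - e <= avg (fun w : {ffun 'I_n -> I} => ramp a b (W w)) <= Phi b + e.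
Proof.
move=> ab e0; have [f [f' [c [/andP[ac cb] df fE uf']]]] := stein_ramp ab.
have [d d0 Hd] := uf' (e / 2) (divr_gt0 e0 (ltr0n _ 2)).
pose C := \sum_u `|y u|.
have sV : (Num.sqrt (n%:R : R))^-1 @[n --> \oo] --> (0 : R).
  apply/gtr0_cvgV0.
    by near=> n; rewrite sqrtr_gt0 ltr0n; near: n; exact: nbhs_infty_gt.
  apply/cvgryPge => A; near=> n.
  apply: (@le_trans _ _ `|A|); first exact: ler_norm.
  rewrite -sqrtr_sqr ler_wsqrtr//; near: n; exact: nbhs_infty_ger.
have sC : (Num.sqrt (n%:R : R))^-1 * C @[n --> \oo] --> (0 : R).
  by rewrite -[X in _ --> X](mul0r C); apply: cvgMl.
near=> n.
have n0 : (0 < n)%N by near: n; exact: nbhs_infty_gt.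
have sn : n%:R * (Num.sqrt (n%:R : R))^-1 ^+ 2 = 1.
  by rewrite exprVn sqr_sqrtr// divff// pnatr_eq0 -lt0n.
have yd u : `|(Num.sqrt (n%:R : R))^-1 * y u| <= d.
  rewrite normrM ger0_norm ?invr_ge0 ?sqrtr_ge0//.
  apply: (@le_trans _ _ ((Num.sqrt (n%:R : R))^-1 * C)).
    rewrite ler_wpM2l ?invr_ge0 ?sqrtr_ge0// /C (bigD1 u)//= lerDl.
    exact: sumr_ge0.
  apply: le_trans (ler_norm _) _.
  by near: n; move/cvgr0Pnorm_le : sC; exact.
have := stein_sum I0 y_mean0 y_var1 df Hd sn yd.
rewrite mulrCA divff// mulr1.
have WE (w : {ffun 'I_n -> I}) : \sum_j (Num.sqrt n%:R)^-1 * y (w j) = W w.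
  by rewrite -mulr_sumr mulrC.
have -> : avg (fun w : {ffun 'I_n -> I} =>
     f' (\sum_j (Num.sqrt n%:R)^-1 * y (w j)) -
     (\sum_j (Num.sqrt n%:R)^-1 * y (w j)) *
     f (\sum_j (Num.sqrt n%:R)^-1 * y (w j))) =
   avg (fun w : {ffun 'I_n -> I} => ramp a b (W w)) - c.
  rewrite -(@avg_cst R {ffun 'I_n -> I} c) ?card_ffun ?expn_gt0 ?I0// -avgB.
  by congr (_ / _); apply: eq_bigr => w _; rewrite WE fE.
rewrite ler_norml => /andP[]; rewrite lerBrDr lerBlDr => h1 h2.
apply/andP; split; first by apply: le_trans h1; rewrite addrC lerD2l.
by apply: le_trans h2 _; rewrite addrC lerD2r.
Unshelve. all: by end_near. Qed.

(** The indicator of the half-line up to [x] lies between the ramps on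
    [x - r, x] and on [x, x + r], whose means are eventually between
    [Phi (x - r)] and [Phi (x + r)] up to a small error; as [Phi] is continuous,
    [r] can be chosen to bring both bounds close to [Phi x]. *)
Lemma clt_uniform x :
  avg (fun w : {ffun 'I_n -> I} => (W w <= x)%R%:R) @[n --> \oo] --> (Phi x : R).
Proof.
apply/cvgrPdist_le => e e0.
have e20 : 0 < e / 2 by rewrite divr_gt0.
have cPhi : {for x, continuous (@Phi R)}.
  apply: differentiable_continuous; apply/derivable1_diffP.
  by case: (is_derive_Phi x).
have [r r0 Hr] : exists2 r, 0 < r &
    forall z, `|x - z| <= r -> `|Phi x - Phi z| <= e / 2.
  have /cvgrPdist_le /(_ _ e20) [r /= r0 Hr] := cPhi.
  exists (r / 2); first by rewrite divr_gt0.
  move=> z xz; apply: Hr; rewrite /ball_/=; apply: le_lt_trans xz _.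
  by rewrite ltr_pdivrMr// ltr_pMr// ltr1n.
have hi : Phi (x + r) <= Phi x + e / 2.
  have := Hr (x + r); rewrite opprD addNKr normrN (gtr0_norm r0) => /(_ (lexx _)).
  by rewrite ler_norml => /andP[? ?]; lra.
have lo : Phi x - e / 2 <= Phi (x - r).
  have := Hr (x - r); rewrite subKr (gtr0_norm r0) => /(_ (lexx _)).
  by rewrite ler_norml => /andP[? ?]; lra.
have xr1 : x < x + r by rewrite ltrDl.
have xr2 : x - r < x by rewrite gtrBl.
near=> n; set p := avg _.
have p_le : p <= Phi x + e.
  have /andP[_ h] : Phi x - e / 2 <=
      avg (fun w : {ffun 'I_n -> I} => ramp x (x + r) (W w)) <=
      Phi (x + r) + e / 2.
    by near: n; exact: avg_ramp_near.
  rewrite [e]splitr addrA; apply: le_trans (le_trans h _); last by rewrite lerD2r.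
  apply: le_avg => w; have [wx|_] := leP (W w) x; first by rewrite ramp1.
  by case/andP: (ramp_itv x (x + r) (W w)).
have p_ge : Phi x - e <= p.
  have /andP[h _] : Phi (x - r) - e / 2 <=
      avg (fun w : {ffun 'I_n -> I} => ramp (x - r) x (W w)) <= Phi x + e / 2.
    by near: n; exact: avg_ramp_near.
  rewrite [e]splitr opprD addrA; apply: le_trans (le_trans _ h) _.
    by rewrite lerD2r.
  apply: le_avg => w; have [_|wx] := leP (W w) x; last by rewrite ramp0// ltW.
  by case/andP: (ramp_itv (x - r) x (W w)).
by rewrite ler_norml; apply/andP; split; lra.
Unshelve. all: by end_near. Qed.

End clt.

(** * Laws of butterfly permutations and of independent uniform families *)

Section laws.
Context {R : realType} (m n : nat).
Hypothesis m0 : (0 < m)%N.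
Local Notation Omega := {ffun 'I_n -> 'I_m}.

Lemma card_Omega_neq0 : (#|{: Omega}|%:R : R) != 0.
Proof. by rewrite card_ffun pnatr_eq0 -lt0n expn_gt0 card_ord m0. Qed.

Let sz : size (enum (butterfly m n)) = #|{: Omega}|.
Proof. by rewrite (perm_size (perm_enum_butterfly n m0)) size_map -cardE. Qed.

Let nonnil : enum (butterfly m n) != [::].
Proof.
by rewrite -size_eq0 sz; have := card_Omega_neq0; rewrite pnatr_eq0.
Qed.

Lemma uniform_butterflyE (A : set 'S_(m ^ n)) :
  uniform_seq R (enum (butterfly m n)) A =
  (avg (fun w : Omega => (butterfly_elt w \in A)%:R))%:E.
Proof.
rewrite uniform_seqE// sz /avg; congr ((_ / _)%:E).
rewrite (seq.permP (perm_enum_butterfly n m0)) count_map -sum1_count big_mkcond/=.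
rewrite natr_sum big_enum/=; apply: eq_bigr => w _.
by case: (_ \in A).
Qed.

Lemma expectation_butterflyE (f : 'S_(m ^ n) -> R) : (forall s, 0 <= f s) ->
  ('E_(uniform_seq R (enum (butterfly m n)))[f] =
   (avg (fun w : Omega => f (butterfly_elt w)))%:E)%E.
Proof.
move=> f0; rewrite ge0_expectation_uniform_seq// sz /avg; congr ((_ / _)%:E).
by rewrite (perm_big _ (perm_enum_butterfly n m0))/= big_map big_enum.
Qed.

Section random_butterfly.
Context (d' : measure_display) (T' : measurableType d') (P : probability T' R).
Variable sigma : {RV P >-> 'S_(m ^ n)}.
Hypothesis law_sigma :
  eq_law (distribution P sigma) (uniform_seq R (enum (butterfly m n))).

Lemma pushforward_butterfly (d2 : measure_display) (V : measurableType d2)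
    (F : 'S_(m ^ n) -> V) (A : set V) :
  pushforward P (fun t => F (sigma t)) A =
  (avg (fun w : Omega => (F (butterfly_elt w) \in A)%:R))%:E.
Proof.
rewrite -[LHS]/(distribution P sigma (F @^-1` A)) law_sigma//.
exact: uniform_butterflyE.
Qed.

Lemma expectation_butterfly (f : 'S_(m ^ n) -> R) : (forall s, 0 <= f s) ->
  ('E_P[fun t => f (sigma t)] = (avg (fun w : Omega => f (butterfly_elt w)))%:E)%E.
Proof.
move=> f0; rewrite -expectation_butterflyE// unlock.
rewrite -(ge0_integral_distribution sigma (f := EFin \o f))//.
by apply: eq_measure_integral => A mA _; exact: law_sigma.
Qed.

End random_butterfly.

(** The law of any function of an independent family of uniform variables. Each
    cell [E w], where the family takes the value of an exponent vector, has
    mass [m ^- n]; the variables are arbitrary outside the cells, but the cells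
    have total mass 1. So the event and its complement have at least the
    masses of the cells that they contain, which forces equality. *)
Lemma pushforward_independent (d' : measure_display) (T' : measurableType d')
    (Q : probability T' R) (X : 'I_n -> {RV Q >-> nat})
    (d2 : measure_display) (V : measurableType d2)
    (G : ('I_n -> nat) -> V) (A : set V) :
  mutually_independent X ->
  (forall j, eq_law (distribution Q (X j)) (uniform_seq R (iota 1 m))) ->
  pushforward Q (fun t => G (fun j => X j t)) A =
  (avg (fun w : Omega => (G (fun j => (w j).+1) \in A)%:R))%:E.
Proof.
move=> indX lawX.
pose E (w : Omega) := \bigcap_j (X j @^-1` [set (w j).+1]).
have mX (v : 'I_n -> nat) : measurable (\bigcap_j (X j @^-1` [set v j])).
  apply: fin_bigcap_measurable => // j _.
  by rewrite -[X in measurable X]setTI; exact: measurable_funP.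
have mE w : measurable (E w) by exact: mX.
have QE w : Q (E w) = (#|{: Omega}|%:R^-1)%:E.
  rewrite indX//.
  rewrite (eq_bigr (fun=> (m%:R^-1)%:E)); last first.
    move=> j _; have := lawX j [set (w j).+1] Logic.I.
    rewrite /distribution /pushforward => ->.
    rewrite uniform_seqE -?size_eq0 ?size_iota -?lt0n//.
    rewrite (eq_count (a2 := pred1 (w j).+1)); last first.
      by move=> k; apply/idP/eqP => [/set_mem//|->]; exact/mem_set.
    rewrite count_uniq_mem ?iota_uniq//.
    have -> : (w j).+1 \in iota 1 m by rewrite mem_iota add1n /= ltnS.
    by rewrite mul1r.
  have prodE (F : 'I_n -> R) : (\prod_j (F j)%:E = (\prod_j F j)%:E)%E.
    by elim/big_rec2 : _ => // j x y _ ->; rewrite EFinM.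
  rewrite prodE.
  by rewrite prodr_const card_ffun !card_ord natrX exprVn.
pose U (C : set V) :=
  \bigcup_(w in [set w : Omega | C (G (fun j => (w j).+1))]) E w.
have QU C : Q (U C) =
    (avg (fun w : Omega => (G (fun j => (w j).+1) \in C)%:R))%:E.
  have tE : trivIset [set w : Omega | C (G (fun j => (w j).+1))] E.
    apply/trivIsetP => w w' _ _; apply: contra_neqP => /eqP/set0P[t [Ew Ew']].
    apply/ffunP => j; apply/ord_inj/succn_inj.
    by rewrite -(Ew j Logic.I : _ = _) (Ew' j Logic.I : _ = _).
  rewrite measure_fin_bigcup//; last exact: finite_finset.
  rewrite fsbig_mkcond (_ : setT = [set` enum {: Omega}]); last first.
    by apply/seteqP; split => // w _; rewrite /= mem_enum.
  rewrite -fsbig_seq ?enum_uniq// big_enum/= /avg mulr_suml -sumEFin.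
  apply: eq_bigr => w _; rewrite patchE QE.
  rewrite (_ : (w \in _) = (G (fun j => (w j).+1) \in C)); last first.
    exact: asbool_equiv_eq.
  by case: ifP; rewrite ?mul1r ?mul0r.
(* Countably many values of the family suffice, as its values are naturals. *)
have mB : measurable ((fun t => G (fun j => X j t)) @^-1` A).
  rewrite (_ : _ @^-1` _ = \bigcup_(v : {ffun 'I_n -> nat})
      (if G v \in A then \bigcap_j (X j @^-1` [set v j]) else set0)).
    apply: countable_bigcupT_measurable; first exact: countableP.
    by move=> v; case: ifP.
  apply/seteqP; split => [t /= At|t [v _]].
    have vE : G [ffun j => X j t] = G (fun j => X j t).
      by congr G; apply/funext => j; rewrite ffunE.
    exists [ffun j => X j t] => //; rewrite vE mem_set//.
    by move=> j _ /=; rewrite ffunE.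
  case: ifPn => [/set_mem Av tv|//] /=.
  by rewrite (_ : (fun j => X j t) = v)//; apply/funext => j; exact: tv.
have UB C : U C `<=` (fun t => G (fun j => X j t)) @^-1` C.
  move=> t [w /= Cw Ew]; rewrite (_ : (fun j => X j t) = (fun j => (w j).+1))//.
  by apply/funext => j; exact: Ew.
have mU C : measurable (U C).
  by apply: fin_bigcup_measurable => //; exact: finite_finset.
have leUB C : measurable ((fun t => G (fun j => X j t)) @^-1` C) ->
    (Q (U C) <= Q ((fun t => G (fun j => X j t)) @^-1` C))%E.
  by move=> mC; apply: le_measure (UB C); rewrite inE.
have avgC : avg (fun w : Omega => (G (fun j => (w j).+1) \in ~` A)%:R) =
    1 - avg (fun w : Omega => (G (fun j => (w j).+1) \in A)%:R) :> R.
  rewrite -[X in _ = X - _](@avg_cst R {: Omega} 1); last first.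
    by rewrite card_ffun expn_gt0 card_ord m0.
  rewrite -avgB.
  congr (_ / _); apply: eq_bigr => w _; rewrite in_setC.
  by case: (_ \in A); rewrite /= ?subrr ?subr0.
apply/eqP; rewrite eq_le -{2}QU leUB// andbT.
have := leUB (~` A); rewrite preimage_setC => /(_ (measurableC mB)).
rewrite QU avgC probability_setC// EFinB.
by rewrite leeD2lE// leeN2.
Qed.
End laws.

(** * Mean and variance of one factor *)

Lemma sum_iota1 (V : nmodType) m (F : nat -> V) :
  \sum_(k <- iota 1 m) F k = \sum_(k < m) F k.+1.
Proof.
rewrite -[RHS](big_mkord xpredT (fun k => F k.+1)) /index_iota subn0.
by rewrite -[1%N]addn0 iotaDl big_map.
Qed.

Section constants.
Context {R : realType} (m : nat).
Hypothesis m2 : (2 <= m)%N.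
Let m0 : (0 < m)%N := ltnW m2.
Let iota_neq0 : iota 1 m != [::].
Proof. by rewrite -size_eq0 size_iota -lt0n. Qed.

Lemma ge0_expectation_unif1m (f : nat -> R) : (forall k, 0 <= f k) ->
  'E_(unif1m R m)[f]%E = (avg (fun k : 'I_m => f k.+1))%:E.
Proof.
move=> f0; rewrite ge0_expectation_uniform_seq// size_iota sum_iota1.
by rewrite /avg card_ord.
Qed.

Let maxX_ge1 k : 1 <= @maxX R m k.
Proof. by rewrite ler1n; lia. Qed.

Let lnm_gt0 : 0 < ln (m%:R : R).
Proof. by rewrite ln_gt0// ltr1n. Qed.

Let l k : R := logm m (maxX R m k).

Let l_ge0 k : 0 <= l k.
Proof. by apply: divr_ge0; [exact: ln_ge0|exact: ltW]. Qed.

Lemma mu_mE : mu_m R m = avg (fun k : 'I_m => l k.+1).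
Proof. by rewrite /mu_m ge0_expectation_unif1m// => k; exact: l_ge0. Qed.

Lemma nu_mE : nu_m R m = avg (fun k : 'I_m => (l k.+1 - mu_m R m) ^+ 2).
Proof.
rewrite /nu_m /variance covariance.unlock -/(mu_m R m) ge0_expectation_unif1m//=.
  by move=> k; rewrite -expr2 sqr_ge0.
Qed.

(** The variance vanishes only if the variable is constant, but
    [max(X, m - X)] is [m - 1] at [X = 1] and [m] at [X = m]. *)
Lemma nu_m_gt0 : 0 < nu_m R m.
Proof.
have m0R : 0 < m%:R :> R by rewrite ltr0n.
rewrite lt_def; apply/andP; split; last first.
  by rewrite nu_mE divr_ge0// sumr_ge0// => k _; exact: sqr_ge0.
apply/negP; rewrite nu_mE mulf_eq0 invr_eq0 card_ord (gt_eqF m0R) orbF.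
rewrite psumr_eq0; last by move=> k _; exact: sqr_ge0.
move=> /allP H; have {}H (k : 'I_m) : l k.+1 = mu_m R m.
  by have := H k (mem_index_enum k); rewrite /= expf_eq0/= subr_eq0 => /eqP.
have H1 := H (Ordinal m0); have m1 : (m.-1 < m)%N by rewrite prednK.
have := H (Ordinal m1); rewrite -H1 /l /logm /maxX/= prednK// subnn maxn0.
move=> /(mulIf (invr_neq0 (lt0r_neq0 lnm_gt0))) /ln_inj.
rewrite !posrE ltr0n m0 ltr0n => /(_ isT) h.
have /eqP := h ltac:(lia); rewrite eqr_nat; lia.
Qed.

End constants.

(** * The length as a product of independent factors *)

Lemma avg_prod {R : realType} (I : finType) (n : nat) (f : I -> R) :
  avg (fun w : {ffun 'I_n -> I} => \prod_j f (w j)) = avg f ^+ n.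
Proof.
rewrite /avg expr_div_n card_ffun card_ord natrX; congr (_ / _).
rewrite -(bigA_distr_bigA (fun _ : 'I_n => f)).
by rewrite prodr_const card_ord.
Qed.

Lemma logm_prod {R : realType} m n (f : 'I_n -> R) : (forall j, 0 < f j) ->
  logm m (\prod_j f j) = \sum_j logm m (f j).
Proof.
move=> f0; rewrite /logm -mulr_suml; congr (_ / _).
suff [] : ln (\prod_j f j) = \sum_j ln (f j) /\ 0 < \prod_j f j by [].
elim/big_rec2 : _ => [|j x p _ [<- p0]]; first by rewrite ln1.
by rewrite lnM ?posrE// mulr_gt0.
Qed.

Lemma avg_lis_butterfly {R : realType} m n : (2 <= m)%N ->
  avg (fun w : {ffun 'I_n -> 'I_m} => (lis (butterfly_elt w))%:R : R) =
  (m ^ n)%N%:R `^ alpha_m R m.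
Proof.
move=> m2; under eq_fun do rewrite lis_butterfly_elt natr_prod.
rewrite (avg_prod n (fun k : 'I_m => maxX R m k.+1)).
have [+ _] := alpha_mE R m2.
rewrite (ge0_expectation_unif1m m2 (f := @maxX R m)); last first.
  by move=> k; exact: ler0n.
move=> [<-].
rewrite natrX -powR_mulrn ?powR_ge0// -powR_mulrn ?ler0n//.
exact: powRAC.
Qed.

Lemma normalized_lis {R : realType} m n (w : {ffun 'I_n -> 'I_m}) :
  (2 <= m)%N ->
  (logm m (lis (butterfly_elt w))%:R - mu_m R m * n%:R)
     * (nu_m R m * n%:R) `^ (- 2^-1)
  = (\sum_j (logm m (maxX R m (w j).+1) - mu_m R m) / Num.sqrt (nu_m R m))
     / Num.sqrt n%:R.
Proof.
move=> m2; have nu0 := nu_m_gt0 (R := R) m2.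
rewrite lis_butterfly_elt natr_prod logm_prod; last first.
  by move=> j; rewrite ltr0n; lia.
have nun0 : 0 <= nu_m R m * n%:R by rewrite mulr_ge0// ltW.
rewrite powRN powR12_sqrt// (sqrtrM _ (ltW nu0)) invfM mulrA.
by rewrite -mulr_suml sumrB sumr_const card_ord mulr_natr.
Qed.

Theorem theorem6 (R : realType) (m : nat) (hm : (2 <= m)%N)
    (d : nat -> measure_display) (T : forall n, measurableType (d n))
    (P : forall n, probability (T n) R)
    (sigma : forall n, {RV (P n) >-> 'S_(m ^ n)})
    (hsigma : forall n, (1 <= n)%N ->
       eq_law (distribution (P n) (sigma n))
              (uniform_seq R (enum (butterfly m n)))) :
  (forall n, (1 <= n)%N ->
     (forall (d' : measure_display) (T' : measurableType d')
             (Q : probability T' R) (X : 'I_n -> {RV Q >-> nat}),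
        mutually_independent X ->
        (forall j, eq_law (distribution Q (X j)) (uniform_seq R (iota 1 m))) ->
        eq_law (pushforward (P n) (fun w => lis (sigma n w)))
               (pushforward Q
                  (fun w => (\prod_(j < n) maxn (X j w) (m - X j w))%N)))
     /\ 'E_(P n)[fun w => (lis (sigma n w))%:R]%E
          = ((m ^ n)%N%:R `^ alpha_m R m)%:E)
  /\ cvg_in_law
       (fun n => pushforward (P n) (fun w =>
          (logm m (lis (sigma n w))%:R - mu_m R m * n%:R)
            * (nu_m R m * n%:R) `^ (- 2^-1)))
       (normal_prob 0 1).
Proof.
have m0 : (0 < m)%N := ltnW hm.
split=> [n n1|x _].
  split=> [d' T' Q X indX lawX A mA|]; last first.
    rewrite -avg_lis_butterfly//.
    exact: (expectation_butterfly m0 (hsigma n n1) (f := fun s => (lis s)%:R)).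
  rewrite (pushforward_butterfly m0 (hsigma n n1) (fun s => lis s)).
  rewrite (pushforward_independent m0
    (fun v => (\prod_(j < n) maxn (v j) (m - v j))%N) A indX lawX).
  by under eq_fun do rewrite lis_butterfly_elt.
pose y (k : 'I_m) : R :=
  (logm m (maxX R m k.+1) - mu_m R m) / Num.sqrt (nu_m R m).
have nu0 := nu_m_gt0 (R := R) hm.
have mR : (m%:R : R) != 0 by rewrite pnatr_eq0 -lt0n.
have y1 : \sum_k y k = 0.
  rewrite -mulr_suml sumrB sumr_const card_ord -(mulr_natr (mu_m R m)).
  by rewrite mu_mE// /avg card_ord divfK// subrr mul0r.
have y2 : \sum_k y k ^+ 2 = #|'I_m|%:R.
  have nuE : \sum_(k < m) (logm m (maxX R m k.+1) - mu_m R m) ^+ 2 =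
      nu_m R m * m%:R.
    by rewrite nu_mE// /avg card_ord divfK.
  under eq_bigr do rewrite exprMn exprVn (sqr_sqrtr (ltW nu0)).
  by rewrite -mulr_suml nuE card_ord mulrAC divff ?mul1r// gt_eqF.
have push n (n1 : (1 <= n)%N) :
    pushforward (P n) (fun w =>
      (logm m (lis (sigma n w))%:R - mu_m R m * n%:R)
        * (nu_m R m * n%:R) `^ (- 2^-1)) `]-oo, x]%classic =
    (avg (fun w : {ffun 'I_n -> 'I_m} =>
       ((\sum_j y (w j)) / Num.sqrt n%:R <= x)%R%:R))%:E.
  rewrite (pushforward_butterfly m0 (hsigma n n1) (fun s : 'S_(m ^ n) =>
    (logm m (lis s)%:R - mu_m R m * n%:R) * (nu_m R m * n%:R) `^ (- 2^-1))).
  congr ((_ / _)%:E); apply: eq_bigr => w _.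
  by rewrite normalized_lis// mem_setE in_itv.
rewrite -PhiE; have Im0 : (0 < #|'I_m|)%N by rewrite card_ord.
apply/fine_cvgP; split.
  near=> n; have n1 : (1 <= n)%N by near: n; exact: nbhs_infty_gt.
  by rewrite (push n n1).
apply: cvg_trans (@clt_uniform R 'I_m y Im0 y1 y2 x).
apply: near_eq_cvg; near=> n; have n1 : (1 <= n)%N by near: n; exact: nbhs_infty_gt.
by rewrite /= (push n n1).
Unshelve. all: by end_near. Qed.
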